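(* Let $\mathcal M(q)=(\mathcal P,\mathcal Z)$ be a finite Möbius plane of order $q$ and let $B$ be a blocking set of $\mathcal M(q)$ of minimum cardinality. Then \[|B|<\frac{q^2+1}{q+1}\left(1+\log(q(q+1))\right).\]
   Context: A Möbius plane is a pair $(\mathcal P,\mathcal Z)$, where $\mathcal P$ is a set (of points) and $\mathcal Z$ is a set of subsets of $\mathcal P$ (circles), such that: (i) any three pairwise distinct points lie on exactly one circle; (ii) if $z\in\mathcal Z$, $P\in z$ and $Q\in\mathcal P\setminus z$, there is exactly one circle $z'$ through $P$ and $Q$ with $z\cap z'=\{P\}$; (iii) there is at least one circle and every circle has at least three points; (iv) for every circle $z$ there is a point not on $z$. It is finite if $\mathcal P$ is finite; then all circles have the same number $q+1$ of points, and $q$ is the order. A blocking set of the Möbius plane is a set $B\subseteq\mathcal P$ meeting every circle. Here $\log$ is the natural logarithm. *)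

(* Defs.v *)
From mathcomp Require Import all_boot all_order all_algebra.

Set Implicit Arguments.
Unset Strict Implicit.
Unset Printing Implicit Defensive.

Section Mobius.
Variables (T : finType) (Z : {set {set T}}).

(* The point set is the whole finite type T; Z is the set of circles. *)
Record mobius_plane : Prop := MobiusPlane {
  mobius_three_points : forall P Q S : T, P != Q -> P != S -> Q != S ->
    exists! z : {set T}, [/\ z \in Z, P \in z, Q \in z & S \in z];
  mobius_touching : forall (z : {set T}) (P Q : T),
    z \in Z -> P \in z -> Q \notin z ->
    exists! z' : {set T},
      [/\ z' \in Z, P \in z', Q \in z' & z :&: z' = [set P]];
  mobius_circle : exists z : {set T}, z \in Z;
  mobius_circle_card : forall z : {set T}, z \in Z -> 3 <= #|z|;
  mobius_off_circle : forall z : {set T}, z \in Z -> exists P : T, P \notin z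
}.

Definition mobius_order (q : nat) : Prop :=
  forall z : {set T}, z \in Z -> #|z| = q.+1.

Definition blocking_set (B : {set T}) : Prop :=
  forall z : {set T}, z \in Z -> B :&: z != set0.

Definition minimum_blocking_set (B : {set T}) : Prop :=
  blocking_set B /\ forall B' : {set T}, blocking_set B' -> #|B| <= #|B'|.

End Mobius.

(* Main.v *)
Require Import Defs.
From mathcomp Require Import all_boot all_order all_algebra.
From mathcomp Require Import reals sequences exp.
From mathcomp Require Import zify.

(** Greedily pick a point on the largest number of the circles not yet met.
    Writing H(n) = 1 + 1/2 + ... + 1/n and deg x for the number of remaining
    circles on x, each pick lowers the sum of w x * H(deg x) by at least 1, for
    every fractional blocking set w; hence some blocking set has at most as many
    points as the initial value of this sum. A Möbius plane of order q has
    q^2 + 1 points, each on q(q+1) circles, so the constant weight 1/(q+1) gives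
    the value (q^2+1)/(q+1) * H(q(q+1)), and H(n) < 1 + log n for n > 1. *)

Set Implicit Arguments.
Unset Strict Implicit.
Unset Printing Implicit Defensive.

Import Order.TTheory GRing.Theory Num.Theory.
Local Open Scope ring_scope.

Section Star.
Variable T : finType.
Implicit Types (F G : {set {set T}}) (A z : {set T}) (x : T).

Definition star F x : {set {set T}} := [set z in F | x \in z].

Lemma card_starID G F x :
  (#|star (F :&: G) x| + #|star (F :\: G) x| = #|star F x|)%N.
Proof.
rewrite -(cardsID G (star F x)).
by congr (_ + _)%N; apply: eq_card => z; rewrite !inE ?andbA // andbAC.
Qed.

Lemma sum_mulrn_star (V : nmodType) F A (w : T -> V) :
  \sum_(x in A) w x *+ #|star F x| = \sum_(z in F) \sum_(x in z :&: A) w x.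
Proof.
transitivity (\sum_(x in A) \sum_(z in F | x \in z) w x).
  apply: eq_bigr => x _; rewrite -sumr_const.
  by apply: eq_bigl => z; rewrite inE.
rewrite (exchange_big_dep (mem F)) /=; last by move=> x z _ /andP[].
apply: eq_bigr => z zF; apply: eq_bigl => x.
by rewrite inE zF andbC.
Qed.

Lemma sum_card_star F A :
  (\sum_(x in A) #|star F x| = \sum_(z in F) #|z :&: A|)%N.
Proof.
rewrite (eq_bigr (fun x => 1 *+ #|star F x|)) => [|x _]; last by rewrite natn.
by rewrite sum_mulrn_star; apply: eq_bigr => z _; rewrite sum1_card.
Qed.

Lemma card_regular_uniform F A d k :
    (forall x, x \in A -> #|star F x| = d) ->
    (forall z, z \in F -> #|z :&: A| = k) ->
  (#|A| * d = #|F| * k)%N.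
Proof.
move=> degA cardF; rewrite -!sum_nat_const -(eq_bigr _ degA) sum_card_star.
exact: eq_bigr cardF.
Qed.

End Star.

Lemma le_series_harmonicD (R : numFieldType) m d k : (m + d <= k)%N ->
  series harmonic m + d%:R / k%:R <= series (@harmonic R) (m + d)%N.
Proof.
move=> le_k; rewrite (addnC m) series_addn lerD2l mulr_natl.
rewrite -[X in _ *+ X](addnK m d) -sumr_const_nat.
apply: ler_sum_nat => i /andP[_ lt_i]; rewrite addnC in le_k.
have lt_ik := leq_trans lt_i le_k.
by rewrite lef_pV2 ?posrE ?ltr0n ?ler_nat // (leq_trans _ lt_ik).
Qed.

Lemma lt_ln1Dx (R : realType) (x : R) : -1 < x -> x != 0 -> ln (1 + x) < x.
Proof.
move=> x_gtN1 x_neq0; rewrite -[ltRHS]expRK ltr_ln ?posrE ?expR_gt0 //.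
  exact: expR_gt1Dx.
by rewrite -ltrBlDl sub0r.
Qed.

Lemma harmonic_lt_lnB (R : realType) n : (0 < n)%N ->
  harmonic n < ln n.+1%:R - ln n%:R :> R.
Proof.
move=> n_gt0; have nS_gt0 : 0 < n.+1%:R :> R by rewrite ltr0n.
have ratioE : n%:R / n.+1%:R = 1 - n.+1%:R^-1 :> R.
  by rewrite -[n%:R](addrK 1) natr1 mulrBl mul1r divff ?gt_eqF.
rewrite -ltrN2 opprB -ln_div ?posrE ?ltr0n //= ratioE.
by rewrite lt_ln1Dx ?oppr_eq0 ?invr_eq0 ?gt_eqF // ltrN2 invf_lt1 // ltr1n.
Qed.

Lemma series_harmonic_lt_1Dln (R : realType) n : (1 < n)%N ->
  series harmonic n < 1 + ln n%:R :> R.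
Proof.
case: n => [//|[//|n]] _; elim: n => [|n IHn]; rewrite seriesSr.
  have -> : series harmonic 1%N = 1 :> R.
    by rewrite seriesEnat /= big_nat1 invr1.
  by have := @harmonic_lt_lnB R 1 isT; rewrite ln1 subr0 ltrD2l.
have := ltrD IHn (@harmonic_lt_lnB R n.+2 isT).
by rewrite -addrA (addrC (ln _)) subrK.
Qed.

Section GreedyBlockingSet.
Variables (R : realFieldType) (T : finType).
Implicit Types (F G : {set {set T}}) (B : {set T}) (w : T -> R).

Definition fractional_blocking_set F w : Prop :=
  (forall x, 0 <= w x) /\ (forall z, z \in F -> 1 <= \sum_(x in z) w x).

Definition harmonic_weight F w : R :=
  \sum_x w x * series harmonic #|star F x|.

Lemma blocking_setU1 F B x :
  blocking_set (F :\: star F x) B -> blocking_set F (x |: B).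
Proof.
move=> blB z zF; rewrite setIUl setU_eq0 negb_and.
have [xz|xz] := boolP (x \in z).
  by apply/orP; left; apply/set0Pn; exists x; rewrite !inE eqxx.
by rewrite blB ?orbT // !inE zF (negbTE xz).
Qed.

Lemma fractional_blocking_setS F G w : G \subset F ->
  fractional_blocking_set F w -> fractional_blocking_set G w.
Proof. by move=> /subsetP sGF [w_ge0 blw]; split=> // z /sGF/blw. Qed.

Lemma le_card_sum_star F w : fractional_blocking_set F w ->
  #|F|%:R <= \sum_x w x *+ #|star F x|.
Proof.
move=> [_ blw]; rewrite -(eq_bigl _ _ (@in_setT T)) sum_mulrn_star.
by rewrite -sumr_const; apply: ler_sum => z zF; rewrite setIT blw.
Qed.

Lemma harmonic_weight_ge0 F w :
  (forall x, 0 <= w x) -> 0 <= harmonic_weight F w.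
Proof.
move=> w_ge0; apply: sumr_ge0 => x _; rewrite mulr_ge0 // seriesEnat.
by apply: sumr_ge0 => i _; apply: harmonic_ge0.
Qed.

(* By [le_series_harmonicD], the term of [x] drops by at least
   [w x * #|star G x| / #|G|]; by double counting these sum to at least 1. *)
Lemma harmonic_weight_setD F G w :
    fractional_blocking_set F w -> G \subset F -> (0 < #|G|)%N ->
    (forall x, #|star F x| <= #|G|)%N ->
  1 + harmonic_weight (F :\: G) w <= harmonic_weight F w.
Proof.
move=> blw sGF G_gt0 deg_le.
have [w_ge0 _] := blw; have blwG := fractional_blocking_setS sGF blw.
have drop_ge1 : 1 <= \sum_x w x * (#|star G x|%:R / #|G|%:R).
  under eq_bigr => x _ do rewrite mulrA mulr_natr.
  by rewrite -mulr_suml ler_pdivlMr ?ltr0n // mul1r le_card_sum_star.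
rewrite addrC -lerBrDl; apply: le_trans drop_ge1 _.
rewrite lerBrDl -big_split; apply: ler_sum => x _ /=.
rewrite -mulrDr ler_wpM2l //.
have degE := card_starID G F x; rewrite (setIidPr sGF) addnC in degE.
by rewrite -degE le_series_harmonicD // degE.
Qed.

Lemma exists_blocking_set_harmonic_weight F w : fractional_blocking_set F w ->
  exists2 B, blocking_set F B & #|B|%:R <= harmonic_weight F w.
Proof.
have [n] := ubnP #|F|; elim: n F => // n IHn F leFn blw.
have [w_ge0 sum_w] := blw; have [F0|[z zF]] := set_0Vmem F.
  exists set0; first by move=> z; rewrite F0 inE.
  by rewrite cards0 harmonic_weight_ge0.
have [y yz] : exists y, y \in z.
  apply/set0Pn; apply: contraTneq (sum_w z zF) => ->.
  by rewrite big_set0 -ltNge ltr01.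
have [x _ x_max] := @arg_maxnP _ y xpredT (fun x => #|star F x|) isT.
have sxF : star F x \subset F by rewrite /star setIdE subsetIl.
have sx_gt0 : (0 < #|star F x|)%N.
  apply: leq_trans (x_max y isT).
  by apply/card_gt0P; exists z; rewrite inE zF.
have [||B blB leB] := IHn (F :\: star F x).
- rewrite ltnS in leFn; apply: leq_trans leFn.
  by rewrite cardsDS // ltn_subrL sx_gt0 (leq_trans sx_gt0) ?subset_leq_card.
- exact: fractional_blocking_setS (subsetDl _ _) blw.
exists (x |: B); first exact: blocking_setU1.
apply: le_trans (harmonic_weight_setD blw sxF sx_gt0 _); last first.
  by move=> u; apply: x_max.
apply: le_trans (lerD (lexx 1) leB).
by rewrite nat1r ler_nat cardsU1 -add1n leq_add2r leq_b1.
Qed.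

Lemma exists_blocking_set_card_degree F r d : (0 < r)%N ->
    (forall z, z \in F -> r <= #|z|)%N -> (forall x, #|star F x| <= d)%N ->
  exists2 B, blocking_set F B
    & #|B|%:R <= #|T|%:R / r%:R * series harmonic d :> R.
Proof.
move=> r_gt0 le_r deg_le.
have [|B blB leB] := @exists_blocking_set_harmonic_weight F (fun=> r%:R^-1).
  split=> [x|z /le_r le_rz]; first by rewrite invr_ge0 ler0n.
  by rewrite sumr_const -[leRHS]mulr_natl ler_pdivlMr ?ltr0n // mul1r ler_nat.
exists B => //; apply: le_trans leB _.
rewrite /harmonic_weight -mulr_sumr mulrAC mulrC ler_wpM2r ?invr_ge0 ?ler0n //.
rewrite mulr_natl -sumr_const; apply: ler_sum => x _.
rewrite seriesEnat; apply: nondecreasing_series (deg_le x) => i _ _.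
exact: harmonic_ge0.
Qed.

End GreedyBlockingSet.

Lemma card_exists_unique (T : finType) (A : {set T}) :
  (exists! x, x \in A) -> #|A| = 1%N.
Proof.
move=> [x [xA Ax]]; apply/eqP/cards1P; exists x; apply/setP => y.
by rewrite inE; apply/idP/eqP => [/Ax|->].
Qed.

Section MobiusCounting.
Variables (T : finType) (Z : {set {set T}}) (q : nat).
Hypotheses (mobZ : mobius_plane Z) (ordZ : mobius_order Z q).
Implicit Types (P Q S : T) (y z : {set T}).

Lemma mobius_order_gt1 : (1 < q)%N.
Proof.
have [z zZ] := mobius_circle mobZ.
by have := mobius_circle_card mobZ zZ; rewrite ordZ.
Qed.

Lemma card_circleD1 P z : z \in star Z P -> #|z :\ P| = q.
Proof.
rewrite inE => /andP[zZ Pz].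
by have := cardsD1 P z; rewrite Pz ordZ // => -[].
Qed.

Lemma cardC_pair_gt0 P Q : (0 < #|~: [set P; Q]|)%N.
Proof.
have [z zZ] := mobius_circle mobZ.
rewrite cardsCs setCK subn_gt0 (leq_trans _ (max_card (mem z))) //.
rewrite (leq_trans _ (mobius_circle_card mobZ zZ)) //.
by rewrite cards2; case: (_ != _).
Qed.

Lemma card_circles_through_triple P Q S : P != Q -> P != S -> Q != S ->
  #|star (star (star Z P) Q) S| = 1%N.
Proof.
move=> PQ PS QS; apply: card_exists_unique.
have [z [[zZ Pz Qz Sz] z_uniq]] := mobius_three_points mobZ PQ PS QS.
exists z; split; first by rewrite !inE zZ Pz Qz.
by move=> y; rewrite !inE -!andbA => /and4P[*]; apply: z_uniq.
Qed.

Lemma card_circleI_le2 y z :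
  y \in Z -> z \in Z -> y != z -> (#|y :&: z| <= 2)%N.
Proof.
move=> yZ zZ; apply: contraNT; rewrite -ltnNge => /card_gt2P[P [Q [S [[]]]]].
rewrite !inE => /andP[Py Pz] /andP[Qy Qz] /andP[Sy Sz] [PQ QS].
rewrite eq_sym => PS.
have /eq_leq/card_le1_eqP circle_eq := card_circles_through_triple PQ PS QS.
by apply/eqP/circle_eq; rewrite !inE ?yZ ?Py ?Qy ?Sy ?zZ ?Pz ?Qz ?Sz.
Qed.

Lemma exists_circle_separating P Q : P != Q ->
  exists2 z, z \in star Z P & Q \notin z.
Proof.
move=> PQ; have /card_gt0P[S] := cardC_pair_gt0 P Q.
rewrite !inE negb_or ![S == _]eq_sym => /andP[PS QS].
have [y [[yZ Py Qy _] _]] := mobius_three_points mobZ PQ PS QS.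
have [U Uy] := mobius_off_circle mobZ yZ.
have [z [[zZ Pz _ yzP] _]] := mobius_touching mobZ yZ Py Uy.
exists z; first by rewrite inE zZ.
by apply: contraNN PQ => Qz; rewrite eq_sym -in_set1 -yzP inE Qy.
Qed.

Lemma card_touching_circles P Q z : z \in star Z P -> Q \notin z ->
  #|[set y in star (star Z P) Q | z :&: y == [set P]]| = 1%N.
Proof.
rewrite inE => /andP[zZ Pz] Qz; apply: card_exists_unique.
have [y [[yZ Py Qy yzP] y_uniq]] := mobius_touching mobZ zZ Pz Qz.
exists y; split; first by rewrite !inE yZ Py Qy yzP eqxx.
by move=> x; rewrite !inE -!andbA => /and4P[xZ Px Qx /eqP xzP]; apply: y_uniq.
Qed.

(* Fix a circle [z] through [P] but not [Q]. A circle through [P] and [Q]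
   either touches [z] at [P], which happens once, or meets [z] in exactly one
   of its [q] points other than [P], which determines it. *)
Lemma card_circles_through_pair P Q : P != Q -> #|star (star Z P) Q| = q.+1.
Proof.
move=> PQ; have [z z_star Qz] := exists_circle_separating PQ.
have := z_star; rewrite inE => /andP[zZ Pz].
have meet_z y : y \in star (star Z P) Q ->
    ((z :&: y == [set P]) + #|y :&: (z :\ P)| = 1)%N.
  rewrite !inE -andbA => /and3P[yZ Py Qy].
  have zy : z != y by apply: contraNneq Qz => ->.
  have := card_circleI_le2 zZ yZ zy.
  rewrite eq_sym eqEcard sub1set cards1 setIDA setIC (cardsD1 P) inE Pz Py /=.
  by case: #|_| => [|[]].
have sum_meet_z : (\sum_(y in star (star Z P) Q) #|y :&: (z :\ P)| = q)%N.
  rewrite -sum_card_star -[RHS](card_circleD1 z_star) -sum1_card.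
  apply: eq_bigr => S; rewrite !inE eq_sym => /andP[PS Sz].
  by apply: card_circles_through_triple => //; apply: contraNneq Qz => ->.
rewrite -sum1_card -(eq_bigr _ meet_z) big_split /= sum_meet_z.
by rewrite -big_mkcondr sum1dep_card card_touching_circles.
Qed.

Lemma card_mobius_points : #|T| = (q ^ 2).+1.
Proof.
have [z zZ] := mobius_circle mobZ.
have /card_gt1P[P [Q [_ _ PQ]]] : (1 < #|z|)%N.
  exact: ltnW (mobius_circle_card mobZ zZ).
have : (#|~: [set P; Q]| * 1 = q.+1 * q.-1)%N.
  rewrite -(card_circles_through_pair PQ).
  apply: card_regular_uniform => [S | y].
    rewrite !inE negb_or ![S == _]eq_sym => /andP[PS QS].
    exact: card_circles_through_triple.
  rewrite !inE -andbA -setDE => /and3P[yZ Py Qy].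
  by rewrite cardsDS ?subUset ?sub1set ?Py // cards2 PQ ordZ // subSS subn1.
rewrite -(cardsC [set P; Q]) cards2 PQ muln1 => ->.
by have := mobius_order_gt1; case: q => // p _; lia.
Qed.

Lemma card_circles_through_point P : #|star Z P| = (q * q.+1)%N.
Proof.
apply/eqP; rewrite -(@eqn_pmul2r q) ?(ltnW mobius_order_gt1) //.
rewrite -(@card_regular_uniform _ _ [set~ P] q.+1) => [|Q|z].
- by rewrite cardsC1 card_mobius_points mulnAC mulnn.
- by rewrite !inE eq_sym => /card_circles_through_pair.
- by rewrite -setDE; apply: card_circleD1.
Qed.

End MobiusCounting.

Theorem mainTheorem8 (R : realType) (T : finType) (Z : {set {set T}})
    (q : nat) (B : {set T}) :
  mobius_plane Z -> mobius_order Z q -> minimum_blocking_set Z B ->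
  #|B|%:R < (q%:R ^+ 2 + 1) / (q%:R + 1) * (1 + ln (q%:R * (q%:R + 1))) :> R.
Proof.
move=> mobZ ordZ [_ B_min].
have q_gt1 := mobius_order_gt1 mobZ ordZ.
have card_circle z : z \in Z -> (q.+1 <= #|z|)%N by move/ordZ->.
have degree P : (#|star Z P| <= q * q.+1)%N.
  by rewrite (card_circles_through_point mobZ ordZ).
have [B' /B_min leB le_harmonic] :=
  @exists_blocking_set_card_degree R T Z q.+1 _ isT card_circle degree.
have card_points := card_mobius_points mobZ ordZ.
rewrite -natrX !natr1 -natrM -card_points.
apply: le_lt_trans (le_trans _ le_harmonic) _; first by rewrite ler_nat.
rewrite ltr_pM2l ?divr_gt0 ?ltr0n ?card_points //.
by rewrite series_harmonic_lt_1Dln // (leq_trans q_gt1) // leq_pmulr.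
Qed.
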